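(* Fix $d\in\mathbb N$. Let $\alpha\in\mathbb R\setminus\mathbb Q$ and let $\mathbf a$ be the bracket word over $\{0,1,\dots,9\}$ given by $a_n=\lfloor 10\{\alpha n^d\}\rfloor$ for $n\in\mathbb N_0$. Then $p_{\mathbf a}(N)\gg_d N^{d(d-1)/2}$ for all $N\in\mathbb N$; that is, there is a constant $c_d>0$ depending only on $d$ such that $p_{\mathbf a}(N)\ge c_d N^{d(d-1)/2}$ for all $N\in\mathbb N$.
   Context: $\mathbb N=\{1,2,\dots\}$, $\mathbb N_0=\mathbb N\cup\{0\}$, and $\{x\}=x-\lfloor x\rfloor$ is the fractional part of $x$. For an infinite word $\mathbf a=(a_n)_{n=0}^\infty$, the subword complexity is $p_{\mathbf a}(N)=|\{a_na_{n+1}\cdots a_{n+N-1}: n\in\mathbb N_0\}|$, the number of distinct length-$N$ blocks of consecutive letters. (A bracket word is a word of the form $a_n=c(g(n))$ with $g\colon\mathbb N_0\to\mathbb R$ a finitely-valued map built from polynomials by means of addition, multiplication and the floor function, and $c$ an arbitrary map on the finite set $g(\mathbb N_0)$.) *)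

(* Defs.v *)
From HB Require Import structures.
From mathcomp Require Import all_boot all_order all_algebra.
From mathcomp Require Import boolp reals.

Set Implicit Arguments.
Unset Strict Implicit.
Unset Printing Implicit Defensive.

Import Order.TTheory GRing.Theory Num.Theory.
Local Open Scope ring_scope.

Definition block (A : Type) (a : nat -> A) (N n : nat) : N.-tuple A :=
  [tuple a (n + i)%N | i < N].

Definition complexity (A : finType) (a : nat -> A) (N : nat) : nat :=
  #|[pred w : N.-tuple A | `[< exists n : nat, w = block a N n >]]|.

Definition fracpart (R : realType) (x : R) : R := x - (Num.floor x)%:~R.

Lemma fracpart_itv (R : realType) (x : R) : 0 <= fracpart x < 1.
Proof.
by rewrite /fracpart subr_ge0 floor_le ltrBlDl -(intrD _ _ 1) floorD1_gt.
Qed.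

Lemma floor10_itv (R : realType) (x : R) :
  0 <= Num.floor (10 * fracpart x) < 10.
Proof.
have /andP[x0 x1] := fracpart_itv x.
by rewrite floor_ge0 mulr_ge0//= floor_lt_int -[ltRHS]mulr1 ltr_pM2l.
Qed.

Lemma absz_floor10_lt (R : realType) (x : R) :
  (`|Num.floor (10 * fracpart x)| < 10)%N.
Proof. by have /andP[x0 x1] := floor10_itv x; rewrite -ltz_nat gez0_abs. Qed.

Definition first_digit (R : realType) (x : R) : 'I_10 :=
  Ordinal (absz_floor10_lt x).

(* The absolute value in [first_digit] only casts from int to nat. *)
Lemma first_digitE (R : realType) (x : R) :
  (first_digit x)%:Z = Num.floor (10 * fracpart x).
Proof. by have /andP[x0 _] := floor10_itv x; rewrite /= gez0_abs. Qed.

Definition digit_word (R : realType) (d : nat) (alpha : R) (n : nat) : 'I_10 :=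
  first_digit (alpha * n%:R ^+ d).

(* Main.v *)
Require Import Defs.
From mathcomp Require Import all_boot all_order all_algebra.
From mathcomp Require Import ring lra.
From mathcomp Require Import boolp classical_sets reals trigo.

(** A block of length [N] read at [n] records, to one decimal digit modulo 1,
    the values at 0, ..., N - 1 of the polynomial
      i |-> alpha (n + i)^d = alpha i^d + \sum_(j < d) 'C(d, j) alpha n^(d-j) i^j.
    Its leading coefficient does not depend on [n], while by Weyl's theorem the
    vector of the other [d] coefficients comes, modulo 1, arbitrarily close to
    any prescribed vector ([word_approximation], from [monomials_dense]).  It
    therefore suffices to exhibit many coefficient vectors whose polynomials can
    be told apart from their approximate values modulo 1 at 0, ..., N - 1.

    Changing the coefficient of i^j by N^-j changes the value near i = N by about
    1, so a grid of spacing comparable to N^-j in direction [j] should do, and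
    it has about N^(0 + 1 + ... + (d-1)) points.  The danger is that a difference
    [h] of two grid polynomials may be close to integers everywhere without being
    small, as i^(p-1) / p is for a large prime [p].  Restricting all coefficients
    to a short interval [0, 1/E), with [E] depending on [d] only, excludes this:
    [h] is then small at the first few integers, and a polynomial of degree less
    than [d] which is small on a long run of integers cannot jump to the
    neighbourhood of a nonzero integer at the next one ([near_int_poly_small]).
    So [h] is honestly small on the whole window, and a finite difference of step
    proportional to N bounds its leading coefficient by less than one grid
    spacing ([lead_coef_bound]); hence [h] = 0 ([grid_separated]).

    Weyl's theorem is proved with real cosines only.  Van der Corput's inequality
    reduces the cancellation of cos(2 pi p(n)) to differences of [p], down to the
    arithmetic progressions, whose cosine sums are explicit ([weyl]).  Density
    then follows by testing against products of Fejer kernels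
    ([weyl_criterion_density]). *)

Set Implicit Arguments.
Unset Strict Implicit.
Unset Printing Implicit Defensive.

Import Order.TTheory GRing.Theory Num.Theory.
Local Open Scope ring_scope.

(** * Irrational numbers and the sine of pi x *)

Lemma irrationalMz (R : realType) (a : R) (k : int) :
  irrational a -> k != 0 -> irrational (k%:~R * a).
Proof.
move=> a_irr k_neq0 [q _ qE]; apply: a_irr; exists (k%:~R^-1 * q) => //.
by rewrite rmorphM/= fmorphV/= ratr_int qE mulKf// intr_eq0.
Qed.

Lemma irrational_not_int (R : realType) (a : R) (m : int) :
  irrational a -> a != m%:~R.
Proof.
by move=> a_irr; apply/eqP => aE; apply: a_irr; exists m%:~R; rewrite ?ratr_int.
Qed.

Lemma abs_sin_pi_fracpart (R : realType) (x : R) :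
  `|sin (pi * x)| = sin (pi * fracpart x).
Proof.
have /andP[t_ge0 t_lt1] := fracpart_itv x.
have sin_shift (y : R) (n : nat) : `|sin (y + pi *+ n)| = `|sin y|.
  by rewrite (alternatingn (@sinDpi R)) normrM normrX normrN1 expr1n mul1r.
rewrite -[RHS]ger0_norm; last first.
  by apply: sin_ge0_pi; rewrite mulr_ge0 ?pi_ge0// ger_pMr ?pi_gt0// ltW.
rewrite /fracpart; case: (Num.floor x) => n.
  rewrite -[in RHS](sin_shift _ n) mulrBr -mulr_natr -pmulrn.
  by congr `|sin _|; ring.
rewrite -[in LHS](sin_shift _ n.+1) NegzE mulrNz opprK mulrDr -mulr_natr -pmulrn.
by [].
Qed.

Lemma sin_pi_neq0 (R : realType) (a : R) : irrational a -> sin (pi * a) != 0.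
Proof.
move=> a_irr; have /andP[t_ge0 t_lt1] := fracpart_itv a.
rewrite -normr_eq0 abs_sin_pi_fracpart gt_eqF// sin_gt0_pi//.
rewrite mulr_gt0 ?pi_gt0 ?gtr_pMr ?pi_gt0 ?t_lt1//.
by rewrite lt_neqAle t_ge0 andbT eq_sym subr_eq0 irrational_not_int.
Qed.

(** By periodicity only the fractional part matters; it lies between
    delta and 1 - delta, where the sine of pi x is at least its value at the nearer end. *)
Lemma sin_pi_far_from_int (R : realType) (delta : R) : 0 < delta ->
  exists2 s : R, 0 < s &
    forall x : R, (forall m : int, delta <= `|x - m%:~R|) ->
    s <= `|sin (pi * x)|.
Proof.
move=> delta_gt0; pose e := Num.min delta 2^-1.
have pi0 := pi_gt0 R.
have e_gt0 : 0 < e by rewrite lt_min delta_gt0 invr_gt0 ltr0n.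
have e_le : e <= 2^-1 by rewrite ge_min lexx orbT.
exists (sin (pi * e)).
  by apply: sin_gt0_pi; rewrite mulr_gt0//= gtr_pMr//; lra.
move=> x far; rewrite abs_sin_pi_fracpart.
have /andP[t_ge0 t_lt1] := fracpart_itv x.
set t := fracpart x in t_ge0 t_lt1 *.
have mono (u v : R) : 0 <= u -> u <= v -> v <= 2^-1 ->
    sin (pi * u) <= sin (pi * v).
  move=> u0 uv v2; have [<-//|u_neq_v] := eqVneq u v.
  have ltuv : u < v by rewrite lt_neqAle u_neq_v.
  apply: ltW; rewrite ltr_sin ?ltr_pM2l//;
    rewrite in_itv/=; apply/andP; split; nra.
have et : e <= t.
  apply: le_trans (_ : delta <= _); first by rewrite ge_min lexx.
  by have := far (Num.floor x); rewrite -/(fracpart x) ger0_norm.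
have et1 : e <= 1 - t.
  apply: le_trans (_ : delta <= _); first by rewrite ge_min lexx.
  have := far (Num.floor x + 1); rewrite intrD opprD addrA -/(fracpart x) -/t.
  by rewrite distrC ger0_norm// subr_ge0 ltW.
have [t_le|t_gt] := leP t 2^-1; first by apply: mono => //; exact: ltW.
have -> : sin (pi * t) = sin (pi * (1 - t)).
  by rewrite [pi * (1 - t)]mulrBr mulr1 sinB sinpi cospi; ring.
by apply: mono; [exact: ltW| exact: et1|lra].
Qed.

(** * Sequences of mean zero *)

Lemma le_bound (R : realType) (x : R) (n : nat) :
  (Num.bound x <= n)%N -> x <= n%:R.
Proof.
move=> xn; have [x_ge0|/ltW x_le0] := leP 0 x; last exact: le_trans x_le0 _.
by apply: ltW; apply: lt_le_trans (archi_boundP x_ge0) _; rewrite ler_nat.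
Qed.

(** The partial averages of [f] tend to 0; the form multiplied by [N] avoids a
    division and makes the case N = 0 harmless. *)
Definition null_average (R : realType) (f : nat -> R) : Prop :=
  forall eps : R, 0 < eps -> exists N0 : nat, forall N : nat, (N0 <= N)%N ->
    `|\sum_(n < N) f n| <= eps * N%:R.

Lemma null_average0 (R : realType) : null_average (fun=> 0 : R).
Proof.
move=> eps eps_gt0; exists 0%N => N _.
by rewrite big1// normr0 mulr_ge0// ltW.
Qed.

Lemma null_averageD (R : realType) (f g : nat -> R) :
  null_average f -> null_average g -> null_average (fun n => f n + g n).
Proof.
move=> f0 g0 eps eps_gt0.
have eps2_gt0 : 0 < eps / 2 by lra.
have [Nf fP] := f0 _ eps2_gt0; have [Ng gP] := g0 _ eps2_gt0.
exists (maxn Nf Ng) => N; rewrite geq_max => /andP[/fP fN /gP gN].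
rewrite big_split/=; apply: le_trans (ler_normD _ _) _.
by have := lerD fN gN; rewrite -mulrDl -splitr.
Qed.

Lemma eq_null_average (R : realType) (f g : nat -> R) :
  f =1 g -> null_average g -> null_average f.
Proof. by move=> /funext ->. Qed.

Lemma null_average_sum (R : realType) (I : Type) (r : seq I) (P : pred I)
    (F : I -> nat -> R) :
  (forall i, P i -> null_average (F i)) ->
  null_average (fun n => \sum_(i <- r | P i) F i n).
Proof.
move=> F0; elim: r => [|i r IHr].
  by apply: eq_null_average (@null_average0 R) => n; rewrite big_nil.
have [Pi|/negPf notPi] := boolP (P i).
  by apply: eq_null_average (null_averageD (F0 i Pi) IHr) => n; rewrite big_cons Pi.
by apply: eq_null_average IHr => n; rewrite big_cons notPi.
Qed.

Lemma null_averageZ (R : realType) (c : R) (f : nat -> R) :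
  null_average f -> null_average (fun n => c * f n).
Proof.
move=> f0 eps eps_gt0.
have c1_gt0 : 0 < `|c| + 1 by rewrite ltr_wpDl.
have [N0 N0P] := f0 _ (divr_gt0 eps_gt0 c1_gt0).
exists N0 => N /N0P fN; rewrite -mulr_sumr normrM.
apply: (@le_trans _ _ ((`|c| + 1) * `|\sum_(n < N) f n|)).
  by rewrite ler_wpM2r// lerDl.
by rewrite mulrC -ler_pdivlMr// mulrAC.
Qed.

Lemma null_average_bounded (R : realType) (f : nat -> R) (C : R) :
  (forall N : nat, `|\sum_(n < N) f n| <= C) -> null_average f.
Proof.
move=> fC eps eps_gt0; exists (Num.bound (C / eps)) => N N_ge.
apply: le_trans (fC N) _; rewrite mulrC -ler_pdivrMr//.
exact: le_bound.
Qed.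

(** * Weyl's theorem on polynomial phases *)

Definition wave (R : realType) (x : R) : R := cos (2 * pi * x).

Lemma wave0 (R : realType) : wave (0 : R) = 1.
Proof. by rewrite /wave mulr0 cos0. Qed.

Lemma wave_le1 (R : realType) (x : R) : `|wave x| <= 1.
Proof. exact: cos_max. Qed.

(** Sines are cosines of a shifted phase, so a family of phases closed under
    adding constants needs a statement about cosines only. *)
Lemma wave_quarter (R : realType) (x : R) : wave (x - 4^-1) = sin (2 * pi * x).
Proof. by rewrite -cosBpihalf /wave; congr cos; field. Qed.

Lemma waveB (R : realType) (x y : R) :
  wave (x - y) = wave x * wave y + wave (x - 4^-1) * wave (y - 4^-1).
Proof. by rewrite !wave_quarter -cosB /wave mulrBr. Qed.

Lemma waveDB (R : realType) (x y : R) :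
  wave (x + y) + wave (x - y) = 2 * (wave x * wave y).
Proof. by rewrite /wave mulrDr mulrBr cosD cosB; ring. Qed.

(** Multiplying by 2 sin(pi a) makes the sum telescope. *)
Lemma wave_sum_arith (R : realType) (a b : R) (N : nat) :
  2 * sin (pi * a) * \sum_(n < N) wave (a * n%:R + b) =
  sin (2 * pi * (a * N%:R + b) - pi * a) - sin (2 * pi * b - pi * a).
Proof.
elim: N => [|N IHN]; first by rewrite big_ord0 !mulr0 add0r subrr.
rewrite big_ord_recr/= mulrDr IHN.
have -> : 2 * pi * (a * N.+1%:R + b) - pi * a =
          2 * pi * (a * N%:R + b) + pi * a by rewrite -natr1; ring.
by rewrite [in RHS]sinD [in LHS]sinB /wave; ring.
Qed.

Lemma wave_sum_arith_bound (R : realType) (a b : R) (N : nat) :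
  `|sin (pi * a)| * `|\sum_(n < N) wave (a * n%:R + b)| <= 1.
Proof.
rewrite -normrM -(ler_pM2l (ltr0n R 2)) mulr1 -[X in X * _ <= _](normr_nat _ 2).
rewrite -normrM mulrA wave_sum_arith.
apply: le_trans (ler_normB _ _) _.
by have := lerD (sin_max (2 * pi * (a * N%:R + b) - pi * a))
  (sin_max (2 * pi * b - pi * a)).
Qed.

(** The square of the modulus of the sum of the exp(2 pi i x_j), in real form. *)
Lemma square_sum_wave (R : realType) (I : finType) (x : I -> R) :
  \sum_i \sum_j wave (x i - x j) =
  (\sum_i wave (x i)) ^+ 2 + (\sum_i wave (x i - 4^-1)) ^+ 2.
Proof.
rewrite !expr2 !big_distrlr/= -big_split; apply: eq_bigr => i _.
by rewrite -big_split; apply: eq_bigr => j _; rewrite waveB.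
Qed.

Lemma shifted_sum_close (R : realType) (c : nat -> R) (N h : nat) :
  (forall n, `|c n| <= 1) ->
  `|\sum_(n < N) c n - \sum_(n < N) c (n + h)%N| <= 2 * h%:R.
Proof.
move=> c_le1; elim: h => [|h IHh].
  by under [X in _ - X]eq_bigr do rewrite addn0; rewrite subrr normr0 mulr0.
have -> : \sum_(n < N) c (n + h.+1)%N =
          \sum_(n < N) c (n + h)%N - c h + c (N + h)%N.
  elim: N {IHh} => [|N IHN]; first by rewrite !big_ord0 add0n; ring.
  by rewrite !big_ord_recr/= IHN addnS addSn; ring.
set A := \sum_(n < N) c n in IHh *; set B := \sum_(n < N) _ in IHh *.
have -> : A - (B - c h + c (N + h)%N) = (A - B) + (c h - c (N + h)%N) by ring.
have := le_trans (ler_normB _ _) (lerD (c_le1 h) (c_le1 (N + h)%N)).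
have := ler_normD (A - B) (c h - c (N + h)%N).
by rewrite -natr1; lra.
Qed.

(** Up to an error of 2 H, the sum of the wave is the average over h < H of its
    shifts by [h].  By [square_sum_wave], the inner sums over [h] have squares
    controlled by the correlations, of which only the [H] diagonal ones do not
    average out; so they are typically of size sqrt(H) instead of [H]. *)
Lemma van_der_corput (R : realType) (f : nat -> R) :
  (forall h h' : nat, h != h' ->
    null_average (fun n => wave (f (n + h)%N - f (n + h')%N))) ->
  null_average (fun n => wave (f n)).
Proof.
move=> corr eps eps_gt0.
have [H H_gt0 H_big] : exists2 H : nat, 0 < H%:R :> R & 8 / eps ^+ 2 <= H%:R.
  by exists (Num.bound (8 / eps ^+ 2)).+1; [rewrite ltr0n|exact: le_bound].
pose offdiag n := \sum_(h < H) \sum_(h' < H | h' != h)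
  wave (f (n + h)%N - f (n + h')%N).
have offdiag0 : null_average offdiag.
  apply: null_average_sum => h _; apply: null_average_sum => h' h'h.
  by apply: corr; rewrite eq_sym.
have [N1 N1P] := offdiag0 _ H_gt0.
pose N2 := Num.bound (4 * H%:R / eps).
exists (maxn N1 N2) => N; rewrite geq_max => /andP[/N1P offdiagN N2N].
have {N2N} N_big : 4 * H%:R <= eps * N%:R.
  by rewrite [eps * _]mulrC -ler_pdivrMr//; exact: le_bound.
pose X := \sum_(n < N) wave (f n).
pose x n := \sum_(h < H) wave (f (n + h)%N).
have x_sqr n : x n ^+ 2 <= H%:R + offdiag n.
  have -> : H%:R + offdiag n =
      \sum_(h < H) \sum_(h' < H) wave (f (n + h)%N - f (n + h')%N).
    rewrite -[H in LHS]card_ord -sumr_const -big_split; apply: eq_bigr => h _.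
    by rewrite [RHS](bigD1 h)//= subrr wave0.
  by rewrite square_sum_wave lerDl sqr_ge0.
have sum_x_sqr : \sum_(n < N) x n ^+ 2 <= 2 * H%:R * N%:R.
  apply: (@le_trans _ _ (\sum_(n < N) (H%:R + offdiag n))).
    by apply: ler_sum => n _; exact: x_sqr.
  rewrite big_split/= sumr_const card_ord -[_ *+ N]mulr_natr.
  have := le_trans (ler_norm _) offdiagN; lra.
have sum_x_close : `|H%:R * X - \sum_(n < N) x n| <= 2 * H%:R * H%:R.
  rewrite exchange_big/= mulr_natl -[H in X *+ H]card_ord -sumr_const -sumrB.
  apply: le_trans (ler_norm_sum _ _ _) _.
  apply: (@le_trans _ _ (\sum_(h < H) 2 * H%:R)); last first.
    by rewrite sumr_const card_ord -[_ *+ H]mulr_natr.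
  apply: ler_sum => h _.
  apply: le_trans (shifted_sum_close (c := fun n => wave (f n)) N h _) _.
    by move=> n; exact: wave_le1.
  by rewrite ler_pM2l// ler_nat ltnW.
(* AM-GM in the form 2 t |x| <= x^2 + t^2 replaces Cauchy-Schwarz, and this [t]
   is the admissible size of [x n]. *)
pose t := H%:R * eps / 2.
have t_gt0 : 0 < t by rewrite /t divr_gt0// mulr_gt0.
have t2_gt0 : 0 < 2 * t by rewrite mulr_gt0.
have sum_x : `|\sum_(n < N) x n| <= H%:R * eps * N%:R / 2.
  apply: le_trans (ler_norm_sum _ _ _) _.
  apply: (@le_trans _ _ (\sum_(n < N) (x n ^+ 2 / (2 * t) + t / 2))).
    apply: ler_sum => n _.
    have -> : x n ^+ 2 / (2 * t) + t / 2 = (x n ^+ 2 + t ^+ 2) / (2 * t).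
      by field; rewrite gt_eqF.
    rewrite ler_pdivlMr// -(real_normK (num_real (x n))).
    by have := sqr_ge0 (`|x n| - t); rewrite sqrrB; lra.
  rewrite big_split/= -mulr_suml sumr_const card_ord -[_ *+ N]mulr_natr.
  have : (\sum_(n < N) x n ^+ 2) / (2 * t) <= t / 2 * N%:R.
    rewrite ler_pdivrMr//.
    apply: le_trans sum_x_sqr _.
    have -> : t / 2 * N%:R * (2 * t) = t ^+ 2 * N%:R by field.
    rewrite ler_wpM2r// /t.
    move: H_big; rewrite ler_pdivrMr ?exprn_gt0// => H_big.
    have := ler_wpM2l (ltW H_gt0) H_big; lra.
  rewrite /t; lra.
have : H%:R * `|X| <= H%:R * (eps * N%:R).
  rewrite -[X in X * _ <= _](ger0_norm (ltW H_gt0)) -normrM.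
  have -> : H%:R * X = (H%:R * X - \sum_(n < N) x n) + \sum_(n < N) x n by ring.
  apply: le_trans (ler_normD _ _) _.
  have := lerD sum_x_close sum_x => /le_trans; apply.
  have := ler_wpM2l (ltW H_gt0) N_big; lra.
by rewrite ler_pM2l.
Qed.

(** Differencing lowers the degree and multiplies the leading coefficient by the
    degree and the step: in the Taylor expansion of the two shifts the constant
    terms cancel, and the terms of order at least 2 have still lower degree. *)
Lemma poly_shift_diff (R : realType) (p : {poly R}) (m : nat) (h h' : R) :
  (size p <= m.+2)%N ->
  exists q : {poly R}, [/\ (size q <= m.+1)%N,
    q`_m = m.+1%:R * (h - h') * p`_m.+1 &
    forall x, q.[x] = p.[x + h] - p.[x + h']].
Proof.
move=> size_p.
pose q := \sum_(i < m.+1) (h ^+ i.+1 - h' ^+ i.+1) *: p^`N(i.+1).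
have coef_q k : (m <= k)%N -> q`_k = (k == m)%:R * (m.+1%:R * (h - h') * p`_m.+1).
  move=> mk; rewrite coef_sum big_ord_recl/= coefZ coef_nderivn expr1.
  rewrite big1 => [|i _]; last first.
    rewrite coefZ coef_nderivn nth_default ?mul0rn ?mulr0//.
    rewrite (leq_trans size_p)// /bump leq0n add1n !addSn !ltnS.
    by rewrite (leq_trans mk)// leq_addl.
  rewrite addr0 expr1 add1n bin1; have [->|k_neq_m] := eqVneq k m.
    by rewrite mul1r -mulr_natr; ring.
  rewrite mul0r nth_default ?mul0rn ?mulr0// (leq_trans size_p)//.
  by rewrite ltnS ltn_neqAle eq_sym k_neq_m.
exists q; split.
- apply/leq_sizeP => k m_lt_k.
  by rewrite coef_q 1?ltnW// gtn_eqF// mul0r.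
- by rewrite coef_q// eqxx mul1r.
move=> x; rewrite !(@nderiv_taylor_wide _ m.+2)//; try exact: mulrC.
rewrite ![\sum_(_ < m.+2) _]big_ord_recl/= !expr0 opprD addrACA subrr add0r -sumrB.
rewrite horner_sum; apply: eq_bigr => i _.
by rewrite hornerZ /bump leq0n add1n -mulrBr mulrC.
Qed.

(** Induction on the degree: the correlations of the phase [p] are waves with
    phase p(n + h) - p(n + h'), whose leading coefficient is a nonzero integer
    multiple of that of [p], hence irrational. *)
Lemma weyl (R : realType) (m : nat) (p : {poly R}) :
  (size p <= m.+2)%N -> irrational p`_m.+1 ->
  null_average (fun n => wave p.[n%:R]).
Proof.
elim: m p => [|m IHm] p size_p irr_p; last first.
  apply: van_der_corput => h h' h_neq_h'.
  have [q [size_q lead_q qE]] := poly_shift_diff h%:R h'%:R size_p.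
  rewrite (_ : (fun n => _) = fun n => wave q.[n%:R]); last first.
    by apply/funext => n; rewrite qE !natrD.
  apply: IHm size_q _.
  have -> : q`_m.+1 = (m.+2%:Z * (h%:Z - h'%:Z))%:~R * p`_m.+2.
    by rewrite lead_q intrM intrB.
  apply: irrationalMz irr_p _.
  by rewrite mulf_neq0// subr_eq0 eqz_nat.
have s_gt0 : 0 < `|sin (pi * p`_1)| by rewrite normr_gt0 sin_pi_neq0.
apply: (@null_average_bounded _ _ (`|sin (pi * p`_1)|^-1)) => N.
rewrite -[leRHS]mulr1 ler_pdivlMl//.
apply: le_trans (wave_sum_arith_bound p`_1 p`_0 N).
rewrite le_eqVlt; apply/orP; left; apply/eqP; congr (_ * `|_|).
apply: eq_bigr => n _; congr wave.
by rewrite (horner_coef_wide _ size_p) !big_ord_recr big_ord0/= !expr0 expr1; ring.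
Qed.

(** * Fejer kernels and density modulo 1 *)

Lemma exists_gt0_of_mean (R : realType) (F : nat -> R) (mu : R) :
  0 < mu -> null_average (fun n => F n - mu) -> exists n, 0 < F n.
Proof.
move=> mu_gt0 meanF; have mu2_gt0 : 0 < mu / 2 by lra.
have [N0 /(_ N0.+1 (leqnSn _))] := meanF _ mu2_gt0.
rewrite sumrB sumr_const card_ord -[_ *+ N0.+1]mulr_natr => avgF.
apply: contrapT => /forallNP F_le0.
have N_gt0 : 0 < N0.+1%:R :> R by rewrite ltr0n.
have sumF_le0 : \sum_(n < N0.+1) F n <= 0.
  by apply: sumr_le0 => n _; rewrite leNgt; apply/negP/F_le0.
have muN_gt0 := mulr_gt0 mu_gt0 N_gt0.
by move: avgF; rewrite ler_norml => /andP[+ _]; lra.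
Qed.

(** The squared modulus of the sum of the exp(2 pi i k x), k < L; the products
    [k%:R * x] are kept apart so that [square_sum_wave] applies as it is. *)
Definition fejer (R : realType) (L : nat) (x : R) : R :=
  \sum_(k < L) \sum_(l < L) wave (k%:R * x - l%:R * x).

Lemma fejer_ge0 (R : realType) (L : nat) (x : R) : 0 <= fejer L x.
Proof.
by rewrite /fejer (square_sum_wave (fun k : 'I_L => k%:R * x)) addr_ge0 ?sqr_ge0.
Qed.

(** Away from the integers both the cosine and the sine sums are geometric sums
    bounded independently of [L], whereas the mean of the kernel is [L]. *)
Lemma fejer_far (R : realType) (L : nat) (x s : R) :
  0 < s -> s <= `|sin (pi * x)| -> fejer L x <= 2 / s ^+ 2.
Proof.
move=> s_gt0 s_le.
have bound b : (\sum_(k < L) wave (k%:R * x + b)) ^+ 2 <= s ^- 2.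
  rewrite -[leLHS]real_normK ?num_real// -exprVn.
  rewrite ler_pXn2r ?nnegrE ?invr_ge0 ?(ltW s_gt0)//.
  rewrite -[leRHS]mulr1 ler_pdivlMl//.
  apply: le_trans (wave_sum_arith_bound x b L).
  rewrite (eq_bigr (fun k : 'I_L => wave (x * k%:R + b))) => [|k _].
    by rewrite ler_wpM2r.
  by rewrite [x * _]mulrC.
have b0 := bound 0; have b1 := bound (- 4^-1).
rewrite /fejer (square_sum_wave (fun k : 'I_L => k%:R * x)).
rewrite (eq_bigr (fun k : 'I_L => wave (k%:R * x + 0))) => [|k _]; last first.
  by rewrite addr0.
by lra.
Qed.

(** Product-to-sum; the terms with y - (k - l) x are folded onto the others by
    exchanging [k] and [l]. *)
Lemma fejerM_wave (R : realType) (L : nat) (x y : R) :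
  fejer L x * wave y = \sum_(k < L) \sum_(l < L) wave (y + (k%:R - l%:R) * x).
Proof.
pose S := \sum_(k < L) \sum_(l < L) wave (y + (k%:R - l%:R) * x).
have SE : S = \sum_(k < L) \sum_(l < L) wave (y - (k%:R - l%:R) * x).
  rewrite /S exchange_big; apply: eq_bigr => k _; apply: eq_bigr => l _.
  by congr wave; ring.
suff : 2 * (fejer L x * wave y) = S + S by rewrite -/S; lra.
rewrite [in X in _ + X]SE.
rewrite /S -big_split [in RHS]/= mulr_suml mulr_sumr; apply: eq_bigr => k _.
rewrite -big_split [in RHS]/= mulr_suml mulr_sumr; apply: eq_bigr => l _.
by rewrite waveDB -mulrBl [wave y * _]mulrC.
Qed.

(** Multiplying by the kernel in the coordinate [j] only changes the [j]-th
    frequency, so a nonzero frequency at an index outside [s] survives the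
    expansion of the whole product. *)
Lemma null_average_fejer_wave (R : realType) (I : finType) (x : I -> nat -> R)
    (L : nat) (s : seq I) (v : I -> int) :
  (forall v : I -> int, (exists i, v i != 0) ->
    null_average (fun n => wave (\sum_i (v i)%:~R * x i n))) ->
  uniq s -> (exists2 i, i \notin s & v i != 0) ->
  null_average (fun n =>
    (\prod_(i <- s) fejer L (x i n)) * wave (\sum_i (v i)%:~R * x i n)).
Proof.
move=> x_indep; elim: s v => [|j s IHs] v.
  move=> _ [i _ vi]; apply: eq_null_average (x_indep v _); last by exists i.
  by move=> n; rewrite big_nil mul1r.
move=> /andP[_ s_uniq] [i]; rewrite inE negb_or => /andP[i_neq_j i_s] vi.
pose w (k l : nat) (i : I) : int := v i + (i == j)%:Z * (k%:Z - l%:Z).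
have wE n k l : \sum_i (v i)%:~R * x i n + (k%:R - l%:R) * x j n =
    \sum_i (w k l i)%:~R * x i n.
  rewrite (bigD1 j)// [in RHS](bigD1 j)//=.
  rewrite [in RHS](eq_bigr (fun i => (v i)%:~R * x i n)) => [|i' /negPf i'j].
    by rewrite /w eqxx intrD mul1r intrB; ring.
  by rewrite /w i'j mul0r addr0.
apply: (@eq_null_average _ _ (fun n => \sum_(k < L) \sum_(l < L)
    ((\prod_(i <- s) fejer L (x i n)) * wave (\sum_i (w k l i)%:~R * x i n)))).
  move=> n; rewrite big_cons [fejer _ _ * _]mulrC -mulrA fejerM_wave mulr_sumr.
  by apply: eq_bigr => k _; rewrite mulr_sumr; apply: eq_bigr => l _; rewrite wE.
apply: null_average_sum => k _; apply: null_average_sum => l _.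
apply: IHs => //; exists i => //.
by rewrite /w (negPf i_neq_j) mul0r addr0.
Qed.

(** In the expansion of the product only the diagonal terms have frequency zero;
    there are [L] of them for each coordinate. *)
Lemma mean_fejer (R : realType) (I : finType) (x : I -> nat -> R) (L : nat)
    (s : seq I) :
  (forall v : I -> int, (exists i, v i != 0) ->
    null_average (fun n => wave (\sum_i (v i)%:~R * x i n))) ->
  uniq s ->
  null_average (fun n => (\prod_(i <- s) fejer L (x i n)) - L%:R ^+ size s).
Proof.
move=> x_indep; elim: s => [_|j s IHs /andP[j_s s_uniq]].
  apply: eq_null_average (@null_average0 R) => n.
  by rewrite big_nil subrr.
pose w (k l : nat) (i : I) : int := (i == j)%:Z * (k%:Z - l%:Z).
have wE n k l : 0 + (k%:R - l%:R) * x j n = \sum_i (w k l i)%:~R * x i n.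
  rewrite (bigD1 j)//= big1 => [|i /negPf ij]; last by rewrite /w ij mul0r mul0r.
  by rewrite /w eqxx mul1r intrB; ring.
apply: (@eq_null_average _ _ (fun n => \sum_(k < L)
    (((\prod_(i <- s) fejer L (x i n)) - L%:R ^+ size s) +
    \sum_(l < L | l != k)
    ((\prod_(i <- s) fejer L (x i n)) * wave (\sum_i (w k l i)%:~R * x i n))))).
  move=> n; rewrite big_cons [fejer _ _ * _]mulrC /=.
  rewrite -[fejer L (x j n)]mulr1 -[X in _ * (_ * X)](@wave0 R) fejerM_wave.
  rewrite mulr_sumr exprS mulr_natl.
  (* The main term L^(size s) * L is spread over the diagonal terms. *)
  have -> (z : R) : z *+ L = \sum_(k < L) z by rewrite sumr_const card_ord.
  rewrite -sumrB.
  apply: eq_bigr => k _; rewrite mulr_sumr (bigD1 k)//=.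
  rewrite subrr mul0r addr0 wave0 mulr1 addrAC; congr (_ + _).
  by apply: eq_bigr => l _; rewrite wE.
apply: null_average_sum => k _; apply: null_averageD; first exact: IHs.
apply: null_average_sum => l l_neq_k.
apply: null_average_fejer_wave => //; exists j => //.
by rewrite /w eqxx mul1r subr_eq0 eqz_nat eq_sym.
Qed.

(** Let [G] be the product of all kernels, [G_j] that of all but the [j]-th, and
    [C] the bound of [fejer_far].  The mean of G - C \sum_j G_j is
    L^(#|I| - 1) (L - C #|I|), positive for [L] large, so this quantity is positive
    at some [n].  If the coordinate [j] of that point were far from the integers,
    then [G] would be at most C G_j. *)
Lemma weyl_criterion_density (R : realType) (I : finType) (x : I -> nat -> R)
    (delta : R) :
  (forall v : I -> int, (exists i, v i != 0) ->
    null_average (fun n => wave (\sum_i (v i)%:~R * x i n))) ->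
  0 < delta -> exists n, forall i, exists m : int, `|x i n - m%:~R| < delta.
Proof.
move=> x_indep delta_gt0.
have [s s_gt0 s_far] := sin_pi_far_from_int delta_gt0.
pose C := 2 / s ^+ 2; pose L := (Num.bound (C * #|I|%:R)).+1.
have C_ge0 : 0 <= C by rewrite divr_ge0// exprn_ge0// ltW.
have [/card0_eq I0|/card_gt0P[i0 _]] := posnP #|I|.
  by exists 0%N => i; have := I0 i.
have CI_lt : C * #|I|%:R < L%:R.
  apply: lt_le_trans (archi_boundP _) _; first by rewrite mulr_ge0.
  by rewrite ler_nat leqnSn.
pose others j := [seq i <- enum I | i != j].
have size_others j : size (others j) = #|I|.-1.
  rewrite size_filter [#|I|]cardE -(count_predC (pred1 j) (enum I)).
  by rewrite count_uniq_mem ?enum_uniq// mem_enum.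
pose F n := (\prod_(i <- enum I) fejer L (x i n)) -
  C * \sum_j \prod_(i <- others j) fejer L (x i n).
have [||n Fn_gt0] := @exists_gt0_of_mean _ F (L%:R ^+ #|I|.-1 * (L%:R - C * #|I|%:R)).
- by rewrite mulr_gt0 ?subr_gt0// exprn_gt0// ltr0n.
- apply: (@eq_null_average _ _ (fun n =>
    ((\prod_(i <- enum I) fejer L (x i n)) - L%:R ^+ size (enum I)) +
    - C * \sum_j ((\prod_(i <- others j) fejer L (x i n)) -
                   L%:R ^+ size (others j)))).
    move=> n; rewrite sumrB [\sum_i L%:R ^+ _](eq_bigr (fun=> L%:R ^+ #|I|.-1)).
      rewrite sumr_const -cardE -[_ *+ #|I|]mulr_natr /F.
      have -> : L%:R ^+ #|I| = L%:R * L%:R ^+ #|I|.-1 :> R.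
        by rewrite -exprS prednK//; apply/card_gt0P; exists i0.
      by ring.
    by move=> j _; rewrite size_others.
  apply: null_averageD; first by apply: mean_fejer => //; exact: enum_uniq.
  apply: null_averageZ; apply: null_average_sum => j _.
  by apply: mean_fejer => //; rewrite filter_uniq ?enum_uniq.
exists n => j; apply: contrapT => /forallNP far.
have fejer_le : fejer L (x j n) <= C.
  by apply/fejer_far/s_far => // m; rewrite leNgt; apply/negP/far.
have prod_ge0 k : 0 <= \prod_(i <- others k) fejer L (x i n).
  by apply: prodr_ge0 => i _; exact: fejer_ge0.
move: Fn_gt0; rewrite /F ltNge => /negP; apply; rewrite subr_le0.
rewrite (bigD1_seq j) ?mem_enum ?enum_uniq//= -big_filter -/(others j).
apply: le_trans (ler_wpM2r (prod_ge0 j) fejer_le) _.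
rewrite ler_wpM2l// [leRHS](bigD1 j)//= lerDl.
by apply: sumr_ge0 => k _; exact: prod_ge0.
Qed.

(** A nontrivial integer combination of these phases is a polynomial in [n] of
    positive degree; by distinctness of the exponents its leading coefficient is a
    nonzero integer multiple of [alpha]. *)
Lemma monomials_dense (R : realType) (d : nat) (alpha delta : R)
    (b : 'I_d -> nat) (y : 'I_d -> R) :
  irrational alpha -> (forall j, (0 < b j)%N) -> 0 < delta ->
  exists n : nat, forall j : 'I_d, exists m : int,
    `|(b j)%:R * alpha * n%:R ^+ j.+1 - y j - m%:~R| < delta.
Proof.
move=> alpha_irr b_gt0; apply: weyl_criterion_density => v [j0 vj0].
pose p : {poly R} :=
  \sum_j (v j)%:~R *: (((b j)%:R * alpha) *: 'X^(j.+1) - (y j)%:P).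
apply: (@eq_null_average _ _ (fun n => wave p.[n%:R])) => [n|].
  rewrite horner_sum; congr wave; apply: eq_bigr => j _.
  by rewrite hornerZ hornerD hornerN hornerZ hornerXn hornerC.
have [j vj j_max] := @arg_maxnP _ j0 (fun j => v j != 0) (fun j => j) vj0.
have coef_p k : (j <= k)%N -> p`_k.+1 = (k == j)%:R * ((v j * b j)%:~R * alpha).
  move=> jk; rewrite coef_sum (bigD1 j)//= big1 => [|i i_neq_j].
    rewrite coefZ coefB coefZ coefXn coefC/= eqSS intrM.
    by case: eqVneq => _ /=; ring.
  have [->|vi] := eqVneq (v i) 0; first by rewrite scale0r coef0.
  rewrite coefZ coefB coefZ coefXn coefC eqSS gtn_eqF ?mulr0 ?subr0 ?mulr0//.
  by rewrite (leq_trans _ jk)// ltn_neqAle i_neq_j; exact: j_max.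
apply: (@weyl _ j); last first.
  rewrite coef_p// eqxx mul1r; apply: irrationalMz alpha_irr _.
  by rewrite mulf_neq0// eqz_nat -lt0n.
apply/leq_sizeP => -[|k]//; rewrite ltnS => jk.
by rewrite coef_p 1?ltnW// gtn_eqF// mul0r.
Qed.

(** * Polynomials that stay close to integers *)

(** A polynomial of degree less than [d] is recovered at [x] from earlier values
    h(x - p), with weights of total mass below 2.  (Iterated differences would give
    mass 2^d - 1, too much for the application.)  This is Richardson
    extrapolation: from a rule exact below degree d + 1, form the rule with all
    nodes dilated by [k]; on monomials of degree d + 1 its defect is
    K = k^(d+1) times larger, so (K rule - dilated rule) / (K - 1) is exact one
    degree further, at the cost of a factor (K + 1) / (K - 1) in the mass, which
    is as close to 1 as desired. *)
Lemma extrapolation_weights (R : realType) (d : nat) :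
  exists s : seq (R * nat), [/\ all (fun p => (0 < p.2)%N) s,
    \sum_(p <- s) `|p.1| < 2 &
    forall j, (j < d)%N -> \sum_(p <- s) p.1 * p.2%:R ^+ j = (j == 0)%:R].
Proof.
elim: d => [|[_|d [s [s_gt0 s_lt2 sE]]]].
- by exists [::]; split=> //; rewrite big_nil.
- exists [:: (1, 1%N)]; split=> //.
    by rewrite big_seq1 normr1 ltr1n.
  by move=> [|]//; rewrite big_seq1/= mulr1.
pose t := \sum_(p <- s) `|p.1|; have t_lt2 : t < 2 by [].
have t_ge0 : 0 <= t by exact: sumr_ge0.
pose k := (Num.bound (4 / (2 - t))).+2.
pose K : R := k%:R ^+ d.+1.
have k_ge1 : 1 <= k%:R :> R by rewrite ler1n.
have k_le_K : k%:R <= K by rewrite /K exprS ler_peMr ?exprn_ege1// ler0n.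
have k_big : 4 / (2 - t) <= k%:R by apply: le_bound; rewrite leqW.
have K_gt1 : 1 < K by apply: lt_le_trans k_le_K; rewrite ltr1n.
have K1_gt0 : 0 < K - 1 by rewrite subr_gt0.
have K1_neq0 : K - 1 != 0 by rewrite gt_eqF.
exists ([seq (K / (K - 1) * p.1, p.2) | p <- s] ++
        [seq (- (K - 1)^-1 * p.1, (k * p.2)%N) | p <- s]); split.
- rewrite all_cat !all_map; apply/andP; split; first exact: s_gt0.
  by apply: sub_all s_gt0 => p /= p_gt0; rewrite muln_gt0.
- rewrite big_cat !big_map/=.
  rewrite (eq_bigr (fun p => K / (K - 1) * `|p.1|)) => [|p _]; last first.
    by rewrite normrM ger0_norm// divr_ge0 ?ltW// (lt_trans ltr01).
  rewrite [X in _ + X](eq_bigr (fun p => (K - 1)^-1 * `|p.1|)) => [|p _]; last first.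
    by rewrite normrM normrN normfV (gtr0_norm K1_gt0).
  rewrite -!mulr_sumr -/t.
  have -> : K / (K - 1) * t + (K - 1)^-1 * t = (K + 1) * t / (K - 1) by field.
  rewrite ltr_pdivrMr//.
  have : 4 <= K * (2 - t).
    by rewrite -ler_pdivrMr ?subr_gt0//; exact: le_trans k_le_K.
  lra.
move=> j; rewrite ltnS leq_eqVlt big_cat !big_map/= => j_d.
rewrite (eq_bigr (fun p => K / (K - 1) * (p.1 * p.2%:R ^+ j))) => [|p _]; last first.
  by rewrite mulrA.
rewrite [X in _ + X](eq_bigr (fun p =>
  - (K - 1)^-1 * k%:R ^+ j * (p.1 * p.2%:R ^+ j))) => [|p _]; last first.
  by rewrite natrM exprMn; ring.
rewrite -!mulr_sumr.
case/orP: j_d => [/eqP ->|j_d]; first by rewrite -/K/=; field.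
rewrite sE//; case: j {j_d} => [|j]; rewrite ?mulr0 ?addr0//= expr0.
by field.
Qed.

Lemma extrapolation_bound (R : realType) (d : nat) :
  exists2 M : nat, (0 < M)%N & forall (h : {poly R}) (x : nat) (T : R),
    (size h <= d)%N -> (M <= x)%N -> 0 <= T ->
    (forall i : nat, (i < x)%N -> `|h.[i%:R]| <= T) -> `|h.[x%:R]| <= 2 * T.
Proof.
have [s [s_gt0 s_lt2 sE]] := extrapolation_weights R d.
exists (\max_(p <- s) p.2).+1 => // h x T size_h Mx T_ge0 hT.
have p_le p : p \in s -> (p.2 <= x)%N.
  by move=> ps; apply: leq_trans (ltnW Mx); exact: (@leq_bigmax_seq _ _ xpredT snd).
have -> : h.[x%:R] = \sum_(p <- s) p.1 * h.[x%:R - p.2%:R].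
  rewrite (eq_bigr (fun p => \sum_(j < d)
      h^`N(j).[x%:R] * (-1) ^+ j * (p.1 * p.2%:R ^+ j))) => [|p _]; last first.
    rewrite (nderiv_taylor_wide _ size_h) ?mulr_sumr; last exact: mulrC.
    by apply: eq_bigr => j _; rewrite [(- p.2%:R) ^+ j]exprNn; ring.
  rewrite exchange_big/= -[LHS](congr1 (horner h) (addr0 _)).
  rewrite (nderiv_taylor_wide _ size_h); last exact: mulrC.
  apply: eq_bigr => j _; rewrite -mulr_sumr sE// expr0n.
  by case: eqP => [->|_]; rewrite ?expr0 ?mulr1 ?mulr0.
apply: le_trans (ler_norm_sum _ _ _) _.
apply: (@le_trans _ _ (\sum_(p <- s) `|p.1| * T)); last first.
  by rewrite -mulr_suml ler_wpM2r// ltW.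
rewrite big_seq [leRHS]big_seq; apply: ler_sum => p ps.
rewrite normrM ler_wpM2l// -natrB ?p_le//; apply: hT.
by rewrite ltn_subrL (allP s_gt0 _ ps) (leq_trans _ Mx).
Qed.

(** By induction on i >= M: if all earlier values are at most 1/5 in modulus, then
    the next one is at most 2/5, and the only integer within 1/5 of it is 0. *)
Lemma near_int_poly_small (R : realType) (d : nat) :
  exists2 M : nat, (0 < M)%N & forall (h : {poly R}) (N : nat),
    (size h <= d)%N ->
    (forall i : nat, (i < M)%N -> `|h.[i%:R]| <= 5^-1) ->
    (forall i : nat, (i < N)%N -> exists m : int, `|h.[i%:R] - m%:~R| <= 5^-1) ->
    forall i : nat, (i < N)%N -> `|h.[i%:R]| <= 5^-1.
Proof.
have [M M_gt0 MP] := extrapolation_bound R d; exists M => // h N size_h start near.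
elim/ltn_ind => i IHi iN; have [/start//|Mi] := ltnP i M.
have fifth_ge0 : 0 <= 5^-1 :> R by rewrite invr_ge0.
have h_small : `|h.[i%:R]| <= 2 * 5^-1.
  by apply: MP => // j ji; apply: IHi => //; exact: ltn_trans iN.
have [m hm] := near i iN.
suff m0 : m = 0 by move: hm; rewrite m0 subr0.
apply/eqP; rewrite -normr_le0 -ltzD1 add0r -(ltr_int R) intr_norm.
have := ler_normB h.[i%:R] (h.[i%:R] - m%:~R); rewrite opprB addrC subrK.
by lra.
Qed.

(** Taking the difference of step [s] doubles the bound and multiplies the
    leading coefficient by at least [s]. *)
Lemma lead_coef_bound (R : realType) (p : {poly R}) (j s : nat) (T : R) :
  (size p <= j.+1)%N ->
  (forall i : nat, (i <= j * s)%N -> `|p.[i%:R]| <= T) ->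
  s%:R ^+ j * `|p`_j| <= 2 ^+ j * T.
Proof.
elim: j p T => [|j IHj] p T size_p pT.
  by rewrite !expr0 !mul1r (size1_polyC size_p) coefC/= -[p`_0](hornerC _ 0%:R)
    -(size1_polyC size_p) pT.
have [q [size_q lead_q qE]] := poly_shift_diff s%:R 0 size_p.
have /IHj : forall i : nat, (i <= j * s)%N -> `|q.[i%:R]| <= 2 * T.
  move=> i ij; rewrite qE addr0 -natrD.
  apply: le_trans (ler_normB _ _) _.
  have := lerD (pT (i + s)%N _) (pT i _).
  rewrite mulSn addnC leq_add2l ij (leq_trans ij) ?leq_addl//.
  by move=> /(_ isT isT); lra.
move=> /(_ size_q); rewrite lead_q subr0 !normrM !normr_nat => q_le.
rewrite exprSr [2 ^+ j.+1]exprSr -!mulrA.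
have pos : 0 <= s%:R ^+ j * (s%:R * `|p`_j.+1|) by rewrite !mulr_ge0// exprn_ge0.
move: q_le; rewrite -natr1; have := ler0n R j.
set A := s%:R ^+ j in pos *; set B := `|_| in pos *.
by move=> j_ge0; have := mulr_ge0 j_ge0 pos; rewrite /A; nra.
Qed.

(** * A grid of distinguishable coefficients *)

(** The [k]-th admissible value of the coefficient of i^j: for k < q^j these
    values fill the interval [0, 1/E) with spacing 1 / (E q^j). *)
Definition grid_point (R : realType) (E q k j : nat) : R :=
  k%:R / (E%:R * q%:R ^+ j).

(** Let [j] be the largest index where [f] and [g] differ, so that the difference
    [h] of the two polynomials has degree [j]; [j] is positive because f 0 = g 0 = 0.
    With step s = 2 E q, [lead_coef_bound] gives s^j |h_j| <= 2^j / 5, although the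
    grid spacing gives s^j |h_j| >= 2^j E^(j-1). *)
Lemma grid_separated (R : realType) (d : nat) : (0 < d)%N ->
  exists2 E : nat, (0 < E)%N & forall (q : nat) (f g : 'I_d -> nat),
    (0 < q)%N ->
    (forall j : 'I_d, (f j < q ^ j)%N) -> (forall j : 'I_d, (g j < q ^ j)%N) ->
    (forall i : nat, (i < 2 * E * d * q)%N -> exists m : int,
      `|\sum_(j < d) grid_point R E q (f j) j * i%:R ^+ j -
        \sum_(j < d) grid_point R E q (g j) j * i%:R ^+ j - m%:~R| <= 5^-1) ->
    f =1 g.
Proof.
move=> d_gt0; have [M M_gt0 MP] := near_int_poly_small R d.
(* The coefficients of [h] are at most 1/E in modulus, hence its values below [M]
   are at most d M^d / E = 1/5. *)
have [E E_gt0 E_val] : exists2 E : nat, (0 < E)%N &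
    E%:R = 5 * d%:R * M%:R ^+ d :> R.
  exists (5 * d * M ^ d)%N; last by rewrite !natrM natrX.
  by rewrite !muln_gt0 d_gt0 expn_gt0 M_gt0.
exists E => // q f g q_gt0 f_lt g_lt near j0.
have [//|fg_j0] := eqVneq (f j0) (g j0); exfalso.
have [j fg_j j_max] := @arg_maxnP _ j0 (fun j => f j != g j) (fun j => j) fg_j0.
have E_gt0R : 0 < E%:R :> R by rewrite ltr0n.
have q_gt0R : 0 < q%:R :> R by rewrite ltr0n.
pose z (k : 'I_d) : R := grid_point R E q (f k) k - grid_point R E q (g k) k.
have zE k : z k = ((f k)%:R - (g k)%:R) / (E%:R * q%:R ^+ k).
  by rewrite /z /grid_point -mulrBl.
pose h : {poly R} := \sum_(k < d) z k *: 'X^k.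
have hE x : h.[x] = \sum_(k < d) z k * x ^+ k.
  by rewrite horner_sum; apply: eq_bigr => k _; rewrite hornerZ hornerXn.
have coef_h k : h`_k = \sum_(l < d) z l * (k == l)%:R.
  by rewrite coef_sum; apply: eq_bigr => l _; rewrite coefZ coefXn.
have size_h : (size h <= j.+1)%N.
  apply/leq_sizeP => k jk; rewrite coef_h big1// => l _.
  have [kl|_] := eqVneq k l; last by rewrite mulr0.
  suff /eqP fgl : f l == g l by rewrite zE fgl subrr !mul0r.
  by apply: contraLR jk => /j_max; rewrite -leqNgt -kl.
have lead_h : h`_j = z j.
  rewrite coef_h (bigD1 j)//= eqxx mulr1 big1 ?addr0// => l /negPf lj.
  by rewrite eq_sym (inj_eq val_inj) lj mulr0.
have start i : (i < M)%N -> `|h.[i%:R]| <= 5^-1.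
  move=> iM; rewrite hE; apply: le_trans (ler_norm_sum _ _ _) _.
  apply: (@le_trans _ _ (\sum_(k < d) E%:R^-1 * M%:R ^+ d)); last first.
    rewrite sumr_const card_ord E_val -[_ *+ d]mulr_natr.
    rewrite le_eqVlt; apply/orP; left; apply/eqP; field.
    by rewrite expf_neq0 ?pnatr_eq0 -?lt0n.
  apply: ler_sum => k _; rewrite normrM; apply: ler_pM => //.
    rewrite zE normrM normfV (gtr0_norm (mulr_gt0 _ _)) ?exprn_gt0//.
    rewrite invfM mulrCA ger_pMr ?invr_gt0// ler_pdivrMr ?exprn_gt0// mul1r.
    have := f_lt k; have := g_lt k; rewrite -!(ltr_nat R) natrX => gk fk.
    have := ler0n R (f k); have := ler0n R (g k).
    by move=> g0 f0; rewrite ler_norml; apply/andP; split; lra.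
  rewrite normrX normr_nat -!natrX ler_nat.
  apply: (@leq_trans (M ^ k)%N); last by rewrite leq_pexp2l// ltnW.
  by have [->//|k_gt0] := posnP k; rewrite leq_exp2r// ltnW.
pose s := (2 * E * q)%N.
have small i : (i <= j * s)%N -> `|h.[i%:R]| <= 5^-1.
  move=> ijs; apply: (MP h (2 * E * d * q)%N) => //.
  - exact: leq_trans size_h _.
  - move=> i' /near[m hm]; exists m; move: hm; rewrite -sumrB hE.
    by under eq_bigr do rewrite -mulrBl.
  - apply: leq_ltn_trans ijs _.
    rewrite [X in (_ < X)%N]mulnAC [X in (_ < X)%N]mulnC ltn_pmul2r//.
    by rewrite muln_gt0 [(0 < 2 * E)%N]muln_gt0 E_gt0.
have j_gt0 : (0 < j)%N.
  rewrite lt0n; apply: contraNneq fg_j => j0'.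
  by have := f_lt j; have := g_lt j; rewrite j0' !ltnS !leqn0 => /eqP -> /eqP ->.
have fg_ge1 : 1 <= `|(f j)%:R - (g j)%:R| :> R.
  rewrite -[(f j)%:R]/((f j)%:Z%:~R) -[(g j)%:R]/((g j)%:Z%:~R) -intrB -intr_norm.
  by rewrite ler1z -gtz0_ge1 normr_gt0 subr_eq0 eqz_nat.
have := lead_coef_bound size_h small.
rewrite lead_h zE normrM normfV (gtr0_norm (mulr_gt0 _ _)) ?exprn_gt0//.
rewrite /s !natrM !exprMn.
have -> : 2 ^+ j * E%:R ^+ j * q%:R ^+ j *
    (`|(f j)%:R - (g j)%:R| / (E%:R * q%:R ^+ j)) =
    2 ^+ j * (E%:R ^+ j.-1 * `|(f j)%:R - (g j)%:R|) :> R.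
  rewrite -[in E%:R ^+ j](prednK j_gt0) exprS; field.
  by rewrite expf_eq0 !gt_eqF// andbF.
rewrite ler_pM2l ?exprn_gt0//.
have : 1 <= E%:R ^+ j.-1 :> R by rewrite exprn_ege1// ler1n.
move=> /(ler_pM ler01 ler01)/(_ fg_ge1); rewrite mul1r; lra.
Qed.

(** * Counting blocks *)

Lemma leq_card_complexity (A T : finType) (a : nat -> A) (N : nat)
    (F : {pred T}) (n : T -> nat) :
  {in F &, injective (fun t => block a N (n t))} -> (#|F| <= complexity a N)%N.
Proof.
move=> inj; rewrite -(card_in_imset inj) subset_leq_card//.
by apply/fintype.subsetP => w /imsetP[t _ ->]; apply/asboolP; exists (n t).
Qed.

Lemma same_digit_near (R : realType) (x y : R) :
  first_digit x = first_digit y -> exists m : int, `|x - y - m%:~R| <= 10^-1.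
Proof.
move=> xy; exists (Num.floor x - Num.floor y).
have fl : Num.floor (10 * fracpart x) = Num.floor (10 * fracpart y).
  by rewrite -!first_digitE xy.
have := floor_itv (10 * fracpart x); have := floor_itv (10 * fracpart y).
rewrite fl => /andP[+ +] /andP[+ +].
rewrite /fracpart !intrD intrN ler_norml => *; apply/andP; split; lra.
Qed.

(** [monomials_dense] handles the coefficient of i^j, which involves n^(d-j); the
    reversal of indices matches it with the exponents 1, ..., d. *)
Lemma word_approximation (R : realType) (d N : nat) (alpha eps : R)
    (y : 'I_d -> R) :
  irrational alpha -> 0 < eps ->
  exists n : nat, forall i : nat, (i < N)%N -> exists m : int,
    `|alpha * (n + i)%N%:R ^+ d -
      (alpha * i%:R ^+ d + \sum_(j < d) y j * i%:R ^+ j) - m%:~R| <= eps.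
Proof.
move=> alpha_irr eps_gt0.
(* An error [delta] in each of the [d] coefficients costs at most d N^d delta on
   the window. *)
pose delta : R := eps / (d * N ^ d).+1%:R.
have delta_gt0 : 0 < delta by rewrite divr_gt0.
have [j|n nP] := @monomials_dense R d alpha delta
  (fun j => 'C(d, rev_ord j)) (fun j => y (rev_ord j)) alpha_irr _ delta_gt0.
  by rewrite bin_gt0 ltnW.
have {nP} /fin_all_exists[m mP] : forall j : 'I_d, exists m : int,
    `|'C(d, j)%:R * alpha * n%:R ^+ (d - j) - y j - m%:~R| < delta.
  by move=> j; have := nP (rev_ord j); rewrite rev_ordK/= subnSK.
exists n => i iN; exists (\sum_(j < d) m j * i%:Z ^+ j).
have -> : alpha * (n + i)%N%:R ^+ d -
      (alpha * i%:R ^+ d + \sum_(j < d) y j * i%:R ^+ j) -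
      (\sum_(j < d) m j * i%:Z ^+ j)%:~R =
    \sum_(j < d) ('C(d, j)%:R * alpha * n%:R ^+ (d - j) - y j - (m j)%:~R) *
      i%:R ^+ j.
  have -> : alpha * (n + i)%:R ^+ d =
      \sum_(j < d) 'C(d, j)%:R * alpha * n%:R ^+ (d - j) * i%:R ^+ j +
      alpha * i%:R ^+ d.
    rewrite natrD exprDn big_ord_recr/= subnn expr0 mul1r binn mulr1n mulrDr.
    rewrite mulr_sumr; congr (_ + _); apply: eq_bigr => j _.
    by rewrite -mulr_natl; ring.
  have -> : (\sum_(j < d) m j * i%:Z ^+ j)%:~R =
      \sum_(j < d) (m j)%:~R * i%:R ^+ j :> R.
    by rewrite rmorph_sum; apply: eq_bigr => j _; rewrite /= rmorphM rmorphXn.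
  have cancel_lead (u v w z : R) : u + v - (v + w) - z = u - w - z by ring.
  rewrite cancel_lead -!sumrB; apply: eq_bigr => j _; ring.
apply: le_trans (ler_norm_sum _ _ _) _.
apply: (@le_trans _ _ (\sum_(j < d) delta * (N ^ d)%:R)).
  apply: ler_sum => j _; rewrite normrM; apply: ler_pM => //; first exact: ltW.
  rewrite normrX normr_nat -natrX ler_nat.
  apply: (@leq_trans (N ^ j)%N); last by rewrite leq_pexp2l ?(ltnW (ltn_ord j))// (leq_trans _ iN).
  by have [->//|j_gt0] := posnP j; rewrite leq_exp2r// ltnW.
rewrite sumr_const card_ord -[_ *+ d]mulr_natl mulrCA -natrM /delta.
rewrite mulrAC ler_pdivrMr ?ltr0n// ler_pM2l// ler_nat; exact: leqnSn.
Qed.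

Lemma card_grid (d q : nat) : (0 < q)%N ->
  #|family (fun j : 'I_d => [pred k : 'I_(q ^ d) | (k < q ^ j)%N])| =
  (q ^ ((d * (d - 1)) %/ 2))%N.
Proof.
move=> q_gt0; rewrite card_family foldrE big_map big_enum/=.
rewrite (eq_bigr (fun j : 'I_d => q ^ j)%N) => [|j _].
  by rewrite -expn_sum -(big_mkord xpredT id) bin2_sum bin2 divn2 subn1.
have qj_le : (q ^ j <= q ^ d)%N by rewrite leq_pexp2l// ltnW.
by rewrite -sum1_card -(big_ord_widen _ (fun=> 1%N) qj_le) sum1_card card_ord.
Qed.

(** Each grid polynomial is realised up to 1/20 by a position [n f].  Equal blocks
    at [n f] and [n g] agree to 1/10 modulo 1, so the grid polynomials agree to
    1/10 + 1/20 + 1/20 = 1/5 modulo 1, and [grid_separated] applies. *)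
Lemma grid_complexity (R : realType) (d : nat) : (0 < d)%N ->
  exists2 D : nat, (0 < D)%N & forall (alpha : R) (q N : nat),
    irrational alpha -> (0 < q)%N -> (D * q <= N)%N ->
    (q ^ ((d * (d - 1)) %/ 2) <= complexity (digit_word d alpha) N)%N.
Proof.
move=> d_gt0; have [E E_gt0 EP] := grid_separated R d_gt0.
exists (2 * E * d)%N; first by rewrite !muln_gt0 E_gt0.
move=> alpha q N alpha_irr q_gt0 DqN; rewrite -(card_grid d q_gt0).
have eps_gt0 : 0 < 20^-1 :> R by rewrite invr_gt0.
have /choice[n nP] : forall f : {ffun 'I_d -> 'I_(q ^ d)}, _ :=
  fun f => word_approximation N (fun j => grid_point R E q (f j) j) alpha_irr eps_gt0.
apply: (leq_card_complexity (n := n)) => f g /familyP f_lt /familyP g_lt same_word.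
apply/ffunP => j; apply: val_inj; move: j.
apply: (EP q (fun j => f j) (fun j => g j)) => // i iDq.
have iN : (i < N)%N by exact: leq_trans DqN.
have /same_digit_near[m mP] : digit_word d alpha (n f + i) = digit_word d alpha (n g + i).
  have := congr1 (fun w : N.-tuple _ => tnth w (Ordinal iN)) same_word.
  by rewrite !tnth_mktuple.
have [mf mfP] := nP f i iN; have [mg mgP] := nP g i iN.
exists (m - mf + mg); move: mP mfP mgP; rewrite intrD intrB !ler_norml.
move=> /andP[? ?] /andP[? ?] /andP[? ?]; apply/andP; split; lra.
Qed.

Theorem proposition12p3 (R : realType) (d : nat) (d_gt0 : (0 < d)%N) :
  exists2 c : R, 0 < c &
    forall alpha : R, @irrational R alpha ->
    forall N : nat, (0 < N)%N ->
      c * N%:R ^+ ((d * (d - 1)) %/ 2)%N <= (complexity (digit_word d alpha) N)%:R.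
Proof.
have [D D_gt0 DP] := grid_complexity R d_gt0.
set e := ((d * (d - 1)) %/ 2)%N in DP *.
have D2_gt0 : 0 < (2 * D)%:R :> R by rewrite ltr0n muln_gt0.
exists ((2 * D)%:R ^- e); first by rewrite invr_gt0 exprn_gt0.
move=> alpha alpha_irr N N_gt0; rewrite mulrC ler_pdivrMr ?exprn_gt0//.
suff [q qN q_le] : exists2 q : nat,
    (N <= q * (2 * D))%N & (q ^ e <= complexity (digit_word d alpha) N)%N.
  rewrite -!natrX -natrM ler_nat.
  apply: (@leq_trans ((q * (2 * D)) ^ e)%N); last by rewrite expnMn leq_mul2r q_le orbT.
  by have [->//|e_gt0] := posnP e; rewrite leq_exp2r.
(* For N < D no grid is available, but N is bounded and one block is enough. *)
have [q0|q_gt0] := posnP (N %/ D).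
  exists 1%N; last first.
    rewrite exp1n; apply/card_gt0P; exists (block (digit_word d alpha) N 0).
    by apply/asboolP; exists 0%N.
  rewrite mul1n mul2n -addnn; apply: leq_trans (leq_addr _ _).
  by rewrite ltnW// ltnNge -divn_gt0// q0.
exists (N %/ D)%N; last by apply: DP => //; rewrite mulnC leq_trunc_div.
apply: leq_trans (ltnW (ltn_ceil N D_gt0)) _.
by rewrite mulnA leq_mul2r muln2 -addnn -addn1 leq_add2l q_gt0 orbT.
Qed.
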